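(* Let $s(G)$ be a similarity function with values in $\mathbb{N}$. For every univariate graph polynomial with real coefficients $P(G;X)=\sum_{i=0}^{s(G)}h_i(G)X^i$ there is a d.p.-equivalent graph polynomial $Q(G;X)=\sum_{i=0}^{s(G)}H_i(G)X^i$ with real coefficients such that (for every graph $G$) all the roots $z$ of $Q(G;X)$ are real and satisfy $|z|\le 2$.
   Context: Graphs are finite, simple and undirected. A graph parameter is a function on graphs invariant under isomorphism. Here the $h_i(G)$ and $H_i(G)$ are real-valued graph parameters. Two graphs are similar if they have the same number of vertices, the same number of edges and the same number of connected components. A similarity function with values in $\mathbb{N}$ is a graph parameter $s$ with values in $\mathbb{N}$ such that $s(G)=s(H)$ whenever $G$ and $H$ are similar. Two graph polynomials $P$ and $Q$ are d.p.-equivalent if for every two similar graphs $G_1,G_2$: $P(G_1;X)=P(G_2;X)$ if and only if $Q(G_1;X)=Q(G_2;X)$ (equality of polynomials). *)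

(* Defs.v *)
From HB Require Import structures.
From mathcomp Require Import all_boot all_order all_algebra.
From mathcomp Require Import reals complex.

Set Implicit Arguments.
Unset Strict Implicit.
Unset Printing Implicit Defensive.

Import Order.TTheory GRing.Theory Num.Theory.
Local Open Scope ring_scope.

(* The graph without vertices is allowed. *)
Record sgraph : Type := SGraph {
  vertex :> finType;
  adj : rel vertex;
  adj_sym : symmetric adj;
  adj_irrefl : irreflexive adj }.

Definition isomorphic (G1 G2 : sgraph) : Prop :=
  exists2 f : G1 -> G2, bijective f & forall x y, adj (f x) (f y) = adj x y.

Definition edges (G : sgraph) : {set {set G}} :=
  [set [set p.1; p.2] | p : G * G & adj p.1 p.2].

Definition similar_graphs (G1 G2 : sgraph) : Prop :=
  [/\ #|G1| = #|G2|,
      #|edges G1| = #|edges G2| &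
      n_comp (@adj G1) G1 = n_comp (@adj G2) G2].

Definition graph_parameter (T : Type) (p : sgraph -> T) : Prop :=
  forall G1 G2 : sgraph, isomorphic G1 G2 -> p G1 = p G2.

Definition similarity_function (s : sgraph -> nat) : Prop :=
  graph_parameter s /\
  forall G1 G2 : sgraph, similar_graphs G1 G2 -> s G1 = s G2.

(* Coefficients h i G with i > s G are irrelevant, and h (s G) G may be 0:
   s G only bounds the degree. *)
Definition graph_poly (R : nzRingType) (s : sgraph -> nat)
    (h : nat -> sgraph -> R) (G : sgraph) : {poly R} :=
  \sum_(0 <= i < (s G).+1) h i G *: 'X^i.

Definition dp_equivalent (R : nzRingType) (P Q : sgraph -> {poly R}) : Prop :=
  forall G1 G2 : sgraph, similar_graphs G1 G2 -> (P G1 = P G2 <-> Q G1 = Q G2).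

(* Main.v *)
Require Import Defs.
From mathcomp Require Import all_boot all_order all_algebra.
From mathcomp Require Import reals complex.
From mathcomp.analysis Require Import sequences exp.

(** The coefficients [a 0, ..., a n] of a polynomial of degree at most [n] can
    be encoded without loss in another one: the leading coefficient carries
    [a n] and the [n] roots carry the others, the [i]-th root lying strictly
    between [i / (n + 1)] and [(i + 1) / (n + 1)], so that the order of the
    roots tells which of them encodes which coefficient. *)

Set Implicit Arguments.
Unset Strict Implicit.
Unset Printing Implicit Defensive.

Import Order.TTheory GRing.Theory Num.Theory.
Local Open Scope ring_scope.
Local Open Scope complex_scope.

Section RootEncoding.
Variable R : realType.
Implicit Types (x : R) (a b : nat -> R) (n i : nat).

(** The logistic function at [-x], serving as an injection of the real line into the open unit
    interval. *)
Definition squash x : R := (1 + expR x)^-1.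

Lemma squash_gt0 x : 0 < squash x.
Proof. by rewrite invr_gt0 addr_gt0 ?expR_gt0. Qed.

Lemma squash_lt1 x : squash x < 1.
Proof. by rewrite invf_lt1 ?ltrDl ?addr_gt0 ?expR_gt0. Qed.

Lemma squash_inj : injective squash.
Proof. by move=> x y /invr_inj/addrI/expR_inj. Qed.

Definition code_root n a i : R := (i%:R + squash (a i)) / n.+1%:R.

Definition code_roots n a : seq R := mkseq (code_root n a) n.

(* The leading coefficient is positive, so that the polynomial never vanishes,
   even for [n = 0]. *)
Definition code_poly n a : {poly R} :=
  expR (a n) *: \prod_(r <- code_roots n a) ('X - r%:P).

(** Up to the factor [n.+1], consecutive roots are separated by an integer:
    [squash (a i) < 1 < 1 + squash (a i.+1)]. *)
Lemma sorted_code_roots n a : sorted <%R (code_roots n a).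
Proof.
apply/(sortedP 0) => i; rewrite size_mkseq => lt_i1n.
rewrite !nth_mkseq ?(ltnW lt_i1n) // ltr_pM2r ?invr_gt0 ?ltr0n //.
by rewrite -natr1 -addrA ltrD2l ltr_wpDr ?squash_lt1 // ltW ?squash_gt0.
Qed.

Lemma code_root_norm_le1 n a r : r \in code_roots n a -> `|r| <= 1.
Proof.
case/mapP=> i; rewrite mem_iota add0n => /= lt_in ->.
have num_ge0 : 0 <= i%:R + squash (a i) by rewrite addr_ge0 // ltW ?squash_gt0.
rewrite ger0_norm ?divr_ge0 // ler_pdivrMr ?ltr0n // mul1r.
rewrite -natr1 lerD ?ler_nat ?(ltnW lt_in) //.
by rewrite ltW ?squash_lt1.
Qed.

Lemma root_code_poly n a x : root (code_poly n a) x = (x \in code_roots n a).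
Proof. by rewrite rootZ ?root_prod_XsubC // gt_eqF ?expR_gt0. Qed.

Lemma lead_coef_code_poly n a : lead_coef (code_poly n a) = expR (a n).
Proof. by rewrite lead_coefZ (monicP (monic_prod_XsubC _ _ _)) mulr1. Qed.

Lemma size_code_poly n a : size (code_poly n a) = n.+1.
Proof.
by rewrite size_scale ?size_prod_XsubC ?size_mkseq // gt_eqF ?expR_gt0.
Qed.

Lemma code_poly_inj n a b :
  code_poly n a = code_poly n b <-> forall i, (i <= n)%N -> a i = b i.
Proof.
split=> [eq_ab i|eq_ab]; last first.
  rewrite /code_poly eq_ab //; congr (_ *: \prod_(r <- _) _).
  apply/eq_in_map => i; rewrite mem_iota add0n => /= lt_in.
  by rewrite /code_root eq_ab // ltnW.
rewrite leq_eqVlt => /predU1P[->|lt_in].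
  by apply: expR_inj; rewrite -!lead_coef_code_poly eq_ab.
(* A strictly increasing list is determined by its set of members, here the root set of the common
   polynomial. *)
have eq_roots : code_roots n a = code_roots n b.
  apply: lt_sorted_eq (sorted_code_roots n a) (sorted_code_roots n b) _ => x.
  by rewrite -!root_code_poly eq_ab.
have := congr1 (nth 0 ^~ i) eq_roots; rewrite /= !nth_mkseq //.
have n1_neq0 : n.+1%:R^-1 != 0 :> R by rewrite invr_eq0 pnatr_eq0.
by move/(mulIf n1_neq0)/addrI/squash_inj.
Qed.

(** The factorization into linear factors over [R] carries over to [R[i]], so no further roots
    appear there. *)
Lemma complex_root_code_poly n a (z : R[i]) :
  root (map_poly (real_complex R) (code_poly n a)) z ->
  exists2 r : R, r \in code_roots n a & z = r%:C.
Proof.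
rewrite /code_poly map_polyZ /= rootZ; last first.
  by rewrite fmorph_eq0 gt_eqF ?expR_gt0.
rewrite map_prod_XsubC -(big_map (real_complex R) xpredT (fun c => 'X - c%:P)).
by rewrite root_prod_XsubC => /mapP.
Qed.

End RootEncoding.

Lemma graph_poly_eqP (R : nzRingType) (s : sgraph -> nat)
    (h : nat -> sgraph -> R) (G1 G2 : sgraph) (s12 : s G1 = s G2) :
  graph_poly s h G1 = graph_poly s h G2 <->
  forall i, (i <= s G1)%N -> h i G1 = h i G2.
Proof.
rewrite /graph_poly -s12; split=> [|eq_h]; last first.
  by apply: eq_big_nat => i /andP[_ le_is]; rewrite eq_h.
rewrite !big_mkord -!(poly_def _ (h^~ _)) => eq_p i le_is.
by move/polyP/(_ i): eq_p; rewrite !coef_poly ltnS le_is.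
Qed.

Theorem corollary4p27 (R : realType) (s : sgraph -> nat)
    (hs : similarity_function s)
    (h : nat -> sgraph -> R) (hh : forall i : nat, graph_parameter (h i)) :
  exists H : nat -> sgraph -> R,
    [/\ forall i : nat, graph_parameter (H i),
        dp_equivalent (graph_poly s h) (graph_poly s H) &
        forall (G : sgraph) (z : R[i]),
          root (map_poly (real_complex R) (graph_poly s H G)) z ->
          z \is Num.real /\ `|z| <= 2].
Proof.
pose Q (G : sgraph) := code_poly (s G) (h^~ G).
exists (fun i G => (Q G)`_i).
have graph_polyQ G : graph_poly s (fun i G => (Q G)`_i) G = Q G.
  rewrite /graph_poly big_mkord -(poly_def _ (fun i => (Q G)`_i)).
  (* [Q G] has degree exactly [s G], so cutting its expansion after the term of index [s G] loses
     nothing. *)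
  by rewrite -[X in \poly_(_ < X) _](size_code_poly _ (h^~ G)) coefK.
split=> [i G1 G2 iso12|G1 G2 sim12|G z].
- have -> // : Q G1 = Q G2.
  rewrite /Q (hs.1 _ _ iso12); apply/code_poly_inj => j _.
  exact: hh.
- have s12 := hs.2 _ _ sim12.
  (* Either equality of polynomials amounts to agreement of the [h i] on both graphs for all
     [i <= s G1]. *)
  rewrite !graph_polyQ /Q -s12; apply: (iff_trans (graph_poly_eqP h s12)).
  exact: iff_sym (code_poly_inj _ _ _).
rewrite graph_polyQ => /complex_root_code_poly[r r_root ->].
split; first by apply/complex_realP; exists r.
(* The encoding gives the sharper bound 1, which is relaxed to 2 at the end. *)
have le_r1 := code_root_norm_le1 r_root.
rewrite normc_def /= expr0n addr0 sqrtr_sqr.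
have -> : 2 = (2 : R)%:C by rewrite rmorph_nat.
by rewrite lecR (le_trans le_r1) // ler1n.
Qed.
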